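(* Let $p$ be a prime and let $n \geq 0$ be an integer. Let $S$ be the set of partitions $\lambda$ of $n$ in which exactly one part size is repeated a number of times not divisible by $p$. For $\lambda \in S$, write the multiplicity of that part size as $t(\lambda)\,p + y(\lambda)$ with $t(\lambda) \geq 0$ and $1 \leq y(\lambda) \leq p-1$, and let $r(\lambda)$ be the number of distinct part sizes of $\lambda$. Then $$c_{2p,p}(n) \equiv \overline{p}\left(\frac{n}{p}\right) + p \sum_{\lambda \in S} 2^{r(\lambda)} (t(\lambda)+1)\, y(\lambda)^{-1} \pmod{p^2},$$ where $y(\lambda)^{-1}$ denotes (any integer representing) the inverse of $y(\lambda)$ modulo $p$.
   Context: A $k$-colored partition of $n$ is a partition of $n$ in which each part is assigned one of $k$ colors, the order of colors among equal parts not mattering (i.e. a multiset of colored positive integers summing to $n$). For $1 \le j \le k$, a $(k,j)$-colored partition of $n$ is a $k$-colored partition of $n$ in which, for each part size that appears, at most $j$ distinct colors are used among the parts of that size; $c_{k,j}(n)$ is the number of these (with $c_{k,j}(0)=1$), and $$\sum_{n=0}^\infty c_{k,j}(n) q^n = \prod_{n=1}^\infty \left( 1 + \sum_{i=1}^{j} \binom{k}{i} \frac{q^{in}}{(1-q^n)^i} \right).$$ An overpartition of $n$ is a partition of $n$ in which the last occurrence of each part size may or may not be overlined; $\overline{p}(n)$ is the number of overpartitions of $n$, with $\sum_{n\ge 0}\overline{p}(n)q^n = \prod_{k\ge1}\frac{1+q^k}{1-q^k}$. By convention $\overline{p}(x)=0$ if $x$ is not an integer. *)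

(* Defs.v *)
From mathcomp Require Import all_boot all_order all_algebra.

Set Implicit Arguments.
Unset Strict Implicit.
Unset Printing Implicit Defensive.

(* A multiset of positive integers with sum n is encoded by its multiplicity
   function.  The parts and the multiplicities of a partition of n are at most
   n, so finite functions suffice: the index i : 'I_n stands for the part size
   i.+1, and m i is the number of occurrences of i.+1. *)
Definition mults (n : nat) := {ffun 'I_n -> 'I_n.+1}.

Definition partitions (n : nat) : {set mults n} :=
  [set m : mults n | \sum_(i < n) i.+1 * m i == n].

Definition part_sizes (n : nat) (m : mults n) : {set 'I_n} :=
  [set i | 0 < m i].

(* In the k-colored case m (i, c) is the number of parts of size i.+1 and
   color c. *)
Definition col_mults (k n : nat) := {ffun 'I_n * 'I_k -> 'I_n.+1}.

Definition col_partitions (k n : nat) : {set col_mults k n} :=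
  [set m : col_mults k n | \sum_(i < n) \sum_(c < k) i.+1 * m (i, c) == n].

Definition colors_of (k n : nat) (m : col_mults k n) (i : 'I_n) : {set 'I_k} :=
  [set c | 0 < m (i, c)].

Definition kj_partitions (k j n : nat) : {set col_mults k n} :=
  [set m in col_partitions k n | [forall i, #|colors_of m i| <= j]].

Definition ckj (k j n : nat) : nat := #|kj_partitions k j n|.

(* Only the last occurrence of each part size can be overlined, so an
   overpartition is a partition together with the set of its part sizes whose
   last occurrence is overlined. *)
Definition overpartitions (n : nat) : {set mults n * {set 'I_n}} :=
  [set mo : mults n * {set 'I_n} |
    (mo.1 \in partitions n) && (mo.2 \subset part_sizes mo.1)].

Definition pbar (n : nat) : nat := #|overpartitions n|.

Definition pbar_div (n p : nat) : nat := if p %| n then pbar (n %/ p) else 0.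

(* Sizes that do not occur have multiplicity 0, which p divides, so they are
   not in exc_sizes. *)
Definition exc_sizes (p n : nat) (m : mults n) : {set 'I_n} :=
  [set i | ~~ (p %| m i)].

Definition S_set (p n : nat) : {set mults n} :=
  [set m in partitions n | #|exc_sizes p m| == 1].

(* The default value 0 is irrelevant for m in S_set p n. *)
Definition exc_mult (p n : nat) (m : mults n) : nat :=
  if [pick i in exc_sizes p m] is Some i then m i else 0.

Definition t_of (p n : nat) (m : mults n) : nat := exc_mult p m %/ p.
Definition y_of (p n : nat) (m : mults n) : nat := exc_mult p m %% p.
Definition r_of (n : nat) (m : mults n) : nat := #|part_sizes m|.

(* Main.v *)
Require Import Defs.
From mathcomp Require Import all_boot all_order all_algebra.
From mathcomp Require Import ring zify.

(* Forgetting the colors, c_{k,j}(n) is the sum over the partitions lam of n of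
   the product, over the part sizes i, of the number w(m) of ways to color m
   equal parts with at most j of the k colors, where m is the multiplicity of i
   in lam; w(m) = \sum_(1 <= s <= j) 'C(k, s) 'C(m - 1, s - 1) for m > 0.  For
   k = 2p and j = p, modulo p ^ 2, w(t p) = 2 when t > 0, and
   y w(t p + y) = 2 p (t + 1) when 0 < y < p.  Hence only the partitions with at
   most one multiplicity not divisible by p contribute: those with exactly one
   give the sum over S, and those with none are the partitions of n / p with
   all multiplicities scaled by p, whose weights 2 ^ r count overpartitions. *)

Set Implicit Arguments.
Unset Strict Implicit.
Unset Printing Implicit Defensive.

Import GRing.Theory.

Local Open Scope ring_scope.

(** * Binomial coefficients modulo [p] and [p ^ 2] *)

Lemma dvdn_bin_mul (p t s : nat) :
  prime p -> (0 < s < p)%N -> (p %| 'C(t * p, s))%N.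
Proof.
move=> pp /andP[s0 sp]; case: s s0 sp => // s _ sp.
have := mul_bin_diag (t * p) s; move=> e.
have : (p %| s.+1 * 'C(t * p, s.+1))%N by rewrite -e -mulnA mulnCA dvdn_mulr.
by rewrite Euclid_dvdM // gtnNdvd.
Qed.

(** By Pascal's rule, neighbours in row [t * p - 1] add up to an entry of row [t * p] that [p]
    divides, so the residues alternate in sign, starting from 1. *)
Lemma bin_predM_mod (p t s : nat) : prime p -> (0 < t)%N -> (s < p)%N ->
  (p%:Z %| 'C((t * p).-1, s)%:Z - (-1) ^+ s)%Z.
Proof.
move=> pp t0; elim: s => [|s IH] sp; first by rewrite bin0 subrr.
have tp0 : (0 < t * p)%N by rewrite muln_gt0 t0 prime_gt0.
have := binS (t * p).-1 s; rewrite prednK // => e.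
have -> : 'C((t * p).-1, s.+1)%:Z - (-1) ^+ s.+1 =
   'C(t * p, s.+1)%:Z - ('C((t * p).-1, s)%:Z - (-1) ^+ s) :> int.
  by rewrite e PoszD exprS; ring.
apply: rpredB; last by apply: IH; apply: ltnW.
by rewrite dvdzE /= dvdn_bin_mul.
Qed.

(** Vandermonde splits one [p] off the top index: modulo [p] only the two end terms survive, and one
    of them adds 1 to the value for [t]. *)
Lemma bin_prime_mod (p t y : nat) : prime p -> (y < p)%N ->
  ('C(t * p + y, p) = t %[mod p])%N.
Proof.
move=> pp yp; elim: t => [|t IH]; first by rewrite mul0n add0n bin_small.
rewrite mulSn -addnA -binomial.Vandermonde.
case: p pp yp IH => // p pp yp IH.
rewrite big_ord_recl big_ord_recr /= /bump leq0n add1n bin0 mul1n subn0.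
rewrite binn subnn bin0 muln1.
set S := (\sum_(i < _) _)%N; rewrite addnCA -modnDml.
have /eqP -> : (p.+1 %| S)%N.
  apply: dvdn_sum => i _; apply: dvdn_mulr; apply: prime_dvd_bin => //.
  by rewrite /bump /= ltnS ltn_ord.
by rewrite add0n -[t.+1]addn1 -modnDml IH modnDml.
Qed.

Lemma alt_sum_bin (N m : nat) :
  \sum_(s < m.+1) (-1) ^+ s * 'C(N.+1, s)%:Z = (-1) ^+ m * 'C(N, m)%:Z :> int.
Proof.
elim: m => [|m IH]; first by rewrite big_ord1 !bin0.
by rewrite big_ord_recr /= IH binS PoszD exprS; ring.
Qed.

(** Induction on [t] by Vandermonde. The terms containing ['C(p, i)] with [0 < i < p] are compared
    with the alternating sum of these ['C(p, i)], which vanishes for odd [p]. *)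
Lemma bin_predM_mod2 (p t : nat) : prime p -> odd p -> (0 < t)%N ->
  ((p ^ 2)%N%:Z %| 'C((t * p).-1, p.-1)%:Z - 1)%Z.
Proof.
move=> pp op; case: t => // t _.
have p0 := prime_gt0 pp.
elim: t => [|t IH]; first by rewrite mul1n binn subrr.
have e : ((t.+2 * p).-1 = p + (t.+1 * p).-1)%N.
  by rewrite mulSn; case: (p) p0 => // q _; rewrite [(t.+1 * _)%N]mulSn; lia.
rewrite e -binomial.Vandermonde; set N := (t.+1 * p).-1 in IH *.
have := alt_sum_bin p.-1 p.-1; rewrite !prednK // binn.
rewrite (_ : (-1) ^+ p.-1 = 1 :> int); last first.
  by rewrite -signr_odd; case: (p) p0 op => //= q _ /negbTE ->.
case: p pp op p0 @N IH e => // p pp op p0 N IH e /=.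
rewrite !big_ord_recl /= !bin0 expr0 mulr1 mul1n subn0.
set A := \sum_(i < p) _ => eA; set B := (\sum_(i < p) _)%N.
have {}eA : A = 0 by move: eA; lia.
have -> : ('C(N, p) + B)%N%:Z - 1 = 'C(N, p)%:Z - 1 + (B%:Z - A) :> int.
  by rewrite PoszD eA; ring.
apply: rpredD => //.
(* Termwise, p divides both the binomial 'C(p, i) and the difference between
   'C(N, p - i) and its sign. *)
rewrite (big_morph Posz PoszD (erefl _)) /A -sumrB.
apply: rpred_sum => i _; rewrite /bump /= !add1n.
(* Here [p] is the predecessor of the prime, hence even. *)
have -> : (-1) ^+ i.+1 = (-1) ^+ (p - i.+1) :> int.
  rewrite -[LHS]signr_odd -[RHS]signr_odd oddB ?ltn_ord //.
  by move: op => /=; case: odd.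
rewrite [X in _ - X]mulrC PoszM -mulrBr expnS expn1 PoszM.
apply: dvdz_mul; last first.
  by apply: bin_predM_mod => //; rewrite ltnS leq_subr.
by rewrite dvdzE /= prime_dvd_bin //= ltnS ltn_ord.
Qed.

(** * Residues of the local weights *)

(* The number of ways to color m equal parts with at most j of the k colors: s
   counts the colors used minus one. *)
Definition weight (k j m : nat) : nat :=
  if m is m'.+1 then \sum_(s < j) 'C(k, s.+1) * 'C(m', s) else 1.

(** For odd [p], the last summand contains ['C(2 * p, p)], twice a binomial that is 1 modulo
    [p ^ 2]. In the other summands [p] divides ['C(2 * p, s.+1)], so ['C(t * p - 1, s)] may be
    replaced by [(-1) ^+ s]; the resulting alternating sum vanishes modulo [p ^ 2]. *)
Lemma weight_multiple (p t : nat) : prime p -> (0 < t)%N ->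
  ((p ^ 2)%N%:Z %| (weight (2 * p) p (t * p))%:Z - 2)%Z.
Proof.
move=> pp t0; have p0 := prime_gt0 pp.
have [p2|op] := even_prime pp.
  subst p; case: t t0 => // t _.
  rewrite /weight mulSn /= !big_ord_recl big_ord0 /= !bin1 bin0.
  rewrite (_ : 'C(2 * 2, 2) = 6)%N //.
  (* The weight is [4 + 6 * (2 * t + 1)]; removing 2 leaves [4 * (3 * t + 2)]. *)
  apply/dvdzP; exists (3 * t%:Z + 2); lia.
have tp0 : (0 < t * p)%N by rewrite muln_gt0 t0.
have -> : weight (2 * p) p (t * p) =
   (\sum_(s < p) 'C(2 * p, s.+1) * 'C((t * p).-1, s))%N.
  by rewrite /weight; case: (t * p)%N tp0.
have b1 := bin_predM_mod2 pp op t0.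
have b2 := bin_predM_mod2 pp op (isT : 0 < 2)%N.
have := alt_sum_bin (2 * p).-1 p.-1; rewrite !prednK // ?muln_gt0 //.
rewrite (_ : (-1) ^+ p.-1 = 1 :> int); last first.
  by rewrite -signr_odd; case: (p) p0 op => //= q _ /negbTE ->.
have e2 : 'C(2 * p, p) = (2 * 'C((2 * p).-1, p.-1))%N.
  have := mul_bin_diag (2 * p) p.-1; rewrite prednK // -mulnA [(2 * (p * _))%N]mulnCA.
  by move/eqP; rewrite eqn_pmul2l // => /eqP <-.
have bin_dvd : forall q (i : 'I_q), p = q.+1 -> (p%:Z %| 'C(2 * p, i.+1)%:Z)%Z.
  by move=> q i e; rewrite dvdzE /= dvdn_bin_mul //= e ltnS ltn_ord.
have bmod : forall s, (s < p)%N -> (p%:Z %| 'C((t * p).-1, s)%:Z - (-1) ^+ s)%Z.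
  by move=> s; apply: bin_predM_mod.
move: e2 b1 b2 bin_dvd bmod.
set M := (t * p).-1; set K := (2 * p).-1; set L := (2 * p)%N.
case: (p) p0 => // q _ /= e2 b1 b2 bd bmod.
rewrite big_ord_recl big_ord_recr /= e2 bin0 expr0 !mul1r => alt.
rewrite PoszD (big_morph Posz PoszD (erefl _)) /=.
set B := \sum_(i < q) _; set A := \sum_(i < q) _ in alt.
have -> : (B + (2 * 'C(K, q) * 'C(M, q))%N%:Z - 2) =
  (B + A) + ('C(K, q)%:Z - 1) * (2 * 'C(M, q)%:Z - 1)
     + 2 * ('C(M, q)%:Z - 1) :> int.
  have -> : A = 'C(K, q)%:Z - 1 by rewrite -alt addrC addKr.
  by rewrite !PoszM; ring.
apply: rpredD; last by apply: dvdz_mull.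
apply: rpredD; last by apply: dvdz_mulr.
rewrite /B /A -big_split; apply: rpred_sum => i _ /=.
rewrite /bump /= !add1n exprS PoszM expnS expn1 PoszM.
have -> : 'C(L, i.+1)%:Z * 'C(M, i)%:Z + -1 * (-1) ^+ i * 'C(L, i.+1)%:Z =
  'C(L, i.+1)%:Z * ('C(M, i)%:Z - (-1) ^+ i) :> int by ring.
apply: dvdz_mul; first exact: (bd q).
by apply: bmod; apply: leqW.
Qed.

Lemma dvdn_weight (p m : nat) : prime p -> ~~ (p %| m)%N ->
  (p %| weight (2 * p) p m)%N.
Proof.
move=> pp; case: m => [|m] npm; first by rewrite dvdn0 in npm.
have p0 := prime_gt0 pp; rewrite /weight.
case: p pp npm p0 => // p pp npm _.
rewrite big_ord_recr /=; apply: dvdn_add.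
  apply: dvdn_sum => i _; apply: dvdn_mulr; apply: dvdn_bin_mul => //=.
  by rewrite ltnS ltn_ord.
apply: dvdn_mull.
(* Last summand: the prime, now written [p.+1], divides this product by absorption, but does not
   divide [m.+1]. *)
have : (p.+1 %| m.+1 * 'C(m, p))%N by rewrite mul_bin_diag dvdn_mulr.
by rewrite Euclid_dvdM // (negbTE npm).
Qed.

Lemma weight_exceptional (p m : nat) : prime p -> ~~ (p %| m)%N ->
  ((p ^ 2)%N%:Z %| (m %% p)%N%:Z * (weight (2 * p) p m)%:Z
                   - 2 * p%:Z * ((m %/ p)%N%:Z + 1))%Z.
Proof.
move=> pp npm; have p0 := prime_gt0 pp.
(* Multiplying by m rather than by m %% p clears the denominators: m w(m) is
   2p times an integer, which only needs to be known modulo p. *)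
have -> : (m %% p)%N%:Z = m%:Z - (m %/ p)%N%:Z * p%:Z :> int.
  by rewrite {2}(divn_eq m p) PoszD PoszM; ring.
set w := weight _ _ _; set t := (m %/ p)%N.
have -> : (m%:Z - t%:Z * p%:Z) * w%:Z - 2 * p%:Z * (t%:Z + 1) =
  (m * w)%N%:Z - 2 * p%:Z * (t%:Z + 1) - t%:Z * (p%:Z * w%:Z) :> int.
  by rewrite PoszM; ring.
have m0 : (0 < m)%N by case: (m) npm => //; rewrite dvdn0.
apply: rpredB; last first.
  apply: dvdz_mull; rewrite expnS expn1 PoszM; apply: dvdz_mul => //.
  by rewrite dvdzE /= dvdn_weight.
(* Absorption twice: [m] is absorbed into ['C(m, s.+1)], and the factor [s.+1] this releases turns
   ['C(2 * p, s.+1)] into [2 * p * 'C(2 * p - 1, s)]. *)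
have -> : (m * w = 2 * p * \sum_(s < p) 'C((2 * p).-1, s) * 'C(m, s.+1))%N.
  rewrite /w /weight; case: (m) m0 => // m' _.
  rewrite !big_distrr /=; apply: eq_bigr => s _.
  rewrite mulnCA (mul_bin_diag m'.+1 s) [RHS]mulnA mul_bin_diag.
  by rewrite mulnCA mulnA.
have -> : forall S : nat, (2 * p * S)%N%:Z - 2 * p%:Z * (t%:Z + 1) =
  p%:Z * (2 * (S%:Z - (t%:Z + 1))) :> int by move=> S; rewrite !PoszM; ring.
rewrite expnS expn1 PoszM; apply: dvdz_mul => //; apply: dvdz_mull.
(* Modulo [p], ['C(2 * p - 1, s)] is [(-1) ^+ s], so the sum becomes [1 - (-1) ^+ p * 'C(m - 1, p)].
   This is [1 + t], because [(-1) ^+ p] is -1 modulo [p] (also for [p = 2]) and [m - 1] still has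
   quotient [t] by [p]. *)
have alt := alt_sum_bin m.-1 p; rewrite prednK // big_ord_recl bin0 in alt.
have {}alt : \sum_(s < p) (-1) ^+ s * 'C(m, s.+1)%:Z =
   1 - (-1) ^+ p * 'C(m.-1, p)%:Z :> int.
  rewrite -alt expr0 mul1r opprD addrA subrr add0r -sumrN.
  by apply: eq_bigr => i _; rewrite lift0 exprS; ring.
rewrite (big_morph Posz PoszD (erefl _)).
have -> : \sum_(i < p) ('C((2 * p).-1, i) * 'C(m, i.+1))%N%:Z - (t%:Z + 1) =
  \sum_(i < p) ('C((2 * p).-1, i)%:Z - (-1) ^+ i) * 'C(m, i.+1)%:Z
  - (1 + (-1) ^+ p) * 'C(m.-1, p)%:Z + ('C(m.-1, p)%:Z - t%:Z) :> int.
  have -> : \sum_(i < p) ('C((2 * p).-1, i)%:Z - (-1) ^+ i) * 'C(m, i.+1)%:Z =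
    \sum_(i < p) ('C((2 * p).-1, i) * 'C(m, i.+1))%N%:Z -
    \sum_(s < p) (-1) ^+ s * 'C(m, s.+1)%:Z :> int.
    by rewrite -sumrB; apply: eq_bigr => i _; rewrite PoszM; ring.
  by rewrite alt; ring.
apply: rpredD; last first.
  have := @bin_prime_mod p t (m %% p).-1 pp; rewrite /t.
  have y0 : (0 < m %% p)%N by rewrite lt0n.
  rewrite [((m %/ p) * p + _)%N](_ : _ = m.-1); last first.
    by rewrite [in RHS](divn_eq m p) -[in RHS](prednK y0) addnS.
  rewrite -eqz_mod_dvd !modz_nat => -> //.
  by rewrite prednK // ltnW // ltn_pmod.
apply: rpredB.
  by apply: rpred_sum => i _; apply: dvdz_mulr; apply: bin_predM_mod.
apply: dvdz_mulr; have [->|op] := even_prime pp; first by [].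
by rewrite -signr_odd op.
Qed.

(** * Colorings of a single part size *)

Lemma sum_bin_lower (n s : nat) : (\sum_(i < n) 'C(i, s) = 'C(n, s.+1))%N.
Proof.
by elim: n => [|n IH]; rewrite ?big_ord0 // big_ord_recr /= IH binS addnC.
Qed.

(** The series [X / (1 - X)] truncated at degree [N]: it records how often a color that is used
    occurs. *)
Definition pos_poly (N : nat) : {poly nat} := \sum_(a < N.+1 | (0 < a)%N) 'X^a.

Lemma coef_pos_poly (N m : nat) : (pos_poly N)`_m = (0 < m <= N)%N :> nat.
Proof.
rewrite coef_sum; under eq_bigr do rewrite coefXn.
have [mN|mN] := leqP m N; last first.
  rewrite andbF big1 // => i _; rewrite gtn_eqF //.
  by apply: leq_trans mN; rewrite ltn_ord.
rewrite andbT big_mkcond (bigD1 (inord m)) //= inordK // eqxx big1 ?addr0.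
  by case: (m).
move=> i /eqP ne; case: ifP => // _; case: eqP => // e.
by case: ne; apply/val_inj; rewrite /= inordK.
Qed.

(** These are compositions of [m] into [s + 1] positive parts; as [m <= N], the truncation loses
    none. Peeling off one part gives a hockey-stick sum. *)
Lemma coef_pos_polyX (N s m : nat) : (m <= N)%N ->
  (pos_poly N ^+ s.+1)`_m = (if m is m'.+1 then 'C(m', s) else 0)%N.
Proof.
elim: s m => [|s IH] m mN.
  by rewrite expr1 coef_pos_poly mN andbT; case: (m) => //= m'; rewrite bin0.
rewrite exprS coefMr; case: m mN => [|m] mN.
  by rewrite big_ord1 subn0 coef_pos_poly mul0r.
rewrite big_ord_recr /= subnn coef_pos_poly mul0r addr0.
transitivity (\sum_(j < m.+1) (pos_poly N ^+ s.+1)`_j).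
  apply: eq_bigr => i _; rewrite coef_pos_poly.
  have -> : (0 < m.+1 - i <= N)%N by have := ltn_ord i; lia.
  by rewrite mul1r.
rewrite big_ord_recl IH // add0r -sum_bin_lower; apply: eq_bigr => i _.
by rewrite lift0 IH //; have := ltn_ord i; lia.
Qed.

(** Expand a product over the colors: a color in [A] contributes [pos_poly N], any other only
    ['X^0]. *)
Lemma card_fixed_support (k N m : nat) (A : {set 'I_k}) :
  #|[set f : {ffun 'I_k -> 'I_N.+1} |
      ([set c | 0 < f c] == A) && (\sum_c f c == m)]|%N =
  (pos_poly N ^+ #|A|)`_m.
Proof.
have -> : pos_poly N ^+ #|A| =
  \prod_(c < k) \sum_(a < N.+1 | (0 < a)%N == (c \in A)) 'X^a.
  rewrite -prodr_const big_mkcond; apply: eq_bigr => c _.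
  case: (c \in A); first by apply: eq_bigl => a; rewrite eqb_id.
  rewrite (big_pred1 ord0) ?expr0 // => a.
  by rewrite eqbF_neg -eqn0Ngt.
rewrite bigA_distr_big_dep coef_sum -sum1dep_card big_mkcondr /=.
apply: eq_big => [f|f _].
  rewrite inE; apply/eqP/familyP => [<- c|H]; first by rewrite unfold_in /= inE.
  by apply/setP => c; rewrite inE; exact: eqP (H c).
by rewrite -expr_sum coefXn eq_sym; case: eqP.
Qed.

Lemma card_local_colorings (k j N m : nat) : (m <= N)%N ->
  #|[set f : {ffun 'I_k -> 'I_N.+1} |
      (\sum_c f c == m) && (#|[set c | (0 < f c)%N]| <= j)]|%N = weight k j m.
Proof.
move=> mN; rewrite -sum1dep_card.
rewrite (partition_big (fun f : {ffun 'I_k -> 'I_N.+1} => [set c | (0 < f c)%N])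
   (fun A => #|A| <= j)%N) /=; last by move=> f /andP[].
transitivity (\sum_(A : {set 'I_k} | (#|A| <= j)%N) (pos_poly N ^+ #|A|)`_m).
  apply: eq_bigr => A Aj; rewrite -card_fixed_support -sum1dep_card.
  apply: eq_bigl => f; rewrite [RHS]andbC; case: (_ =P A) => [->|]; last by rewrite !andbF.
  by rewrite Aj !andbT.
(* Supports are grouped by size; [inord] is faithful since the sizes are at most [j]. *)
rewrite (partition_big (fun A : {set 'I_k} => inord #|A| : 'I_j.+1) xpredT) //=.
transitivity (\sum_(s < j.+1) 'C(k, s) * ((pos_poly N ^+ s)`_m)%R)%N.
  apply: eq_bigr => s _.
  rewrite (eq_bigl (fun A : {set 'I_k} => #|A| == s)); last first.
    move=> A; apply/andP/eqP => [[Aj /eqP <-]|->]; first by rewrite inordK.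
    by rewrite -ltnS ltn_ord inord_val.
  rewrite (eq_bigr (fun _ => (pos_poly N ^+ s)`_m)); last by move=> A /eqP ->.
  rewrite sum_nat_cond_const; congr muln.
  by rewrite -[in RHS](card_ord k) -card_draws; apply: eq_card => A; rewrite inE.
(* The empty support counts only for [m = 0], where it is the only one; hence the two cases of
   [weight]. *)
rewrite big_ord_recl expr0 coef1 bin0 mul1n /weight.
case: m mN => [|m] mN /=.
  by rewrite big1 // => i _; rewrite /bump leq0n add1n coef_pos_polyX // muln0.
by rewrite add0n; apply: eq_bigr => i _; rewrite /bump leq0n add1n coef_pos_polyX.
Qed.

(** * Forgetting the colors *)

Lemma partition_mult_le (n : nat) (F : 'I_n -> nat) :
  (\sum_(i < n) i.+1 * F i = n)%N -> forall i : 'I_n, (i.+1 * F i <= n)%N.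
Proof. by move=> e i; rewrite -[leqRHS]e (bigD1 i) //= leq_addr. Qed.

Lemma ckj_weight (k j n : nat) :
  ckj k j n = (\sum_(lam in partitions n) \prod_(i < n) weight k j (lam i))%N.
Proof.
(* [h] forgets the colors; its [inord] is exact on colored partitions of [n], where no total
   multiplicity exceeds [n]. *)
pose h (M : col_mults k n) : mults n := [ffun i => inord (\sum_c M (i, c))%N].
have hE M i : M \in col_partitions k n -> h M i = (\sum_c M (i, c))%N :> nat.
  rewrite inE => /eqP e; rewrite ffunE inordK //.
  have := @partition_mult_le n (fun i => \sum_c M (i, c))%N.
  have -> : (\sum_(i < n) i.+1 * \sum_c M (i, c) = n)%N.
    by rewrite -[RHS]e; apply: eq_bigr => ? _; rewrite big_distrr.
  by move=> /(_ erefl i); rewrite ltnS; apply: leq_trans; rewrite leq_pmull.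
have hP M : M \in col_partitions k n -> h M \in partitions n.
  move=> MP; rewrite inE; move: (MP); rewrite inE => /eqP e; rewrite -[eqbRHS]e.
  by apply/eqP; apply: eq_bigr => i _; rewrite hE // big_distrr.
rewrite /ckj -sum1_card (partition_big h (mem (partitions n))) /=; last first.
  by move=> M; rewrite inE => /andP[/hP].
apply: eq_bigr => lam lamP.
pose Q i := [pred f : {ffun 'I_k -> 'I_n.+1} |
   (\sum_c f c == lam i)%N && (#|[set c | (0 < f c)%N]| <= j)%N].
transitivity (\prod_(i < n) \sum_(f | Q i f) 1)%N; last first.
  apply: eq_bigr => i _; rewrite -(@card_local_colorings k j n (lam i)).
    by rewrite -sum1dep_card; apply: eq_bigl.
  by rewrite -ltnS ltn_ord.
(* After distributing, the right side counts families of local colorings; currying identifies them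
   with the fiber of [h] over [lam]. *)
rewrite bigA_distr_big_dep.
pose cur (M : col_mults k n) : {ffun 'I_n -> {ffun 'I_k -> 'I_n.+1}} :=
  [ffun i => [ffun c => M (i, c)]].
pose unc (g : {ffun 'I_n -> {ffun 'I_k -> 'I_n.+1}}) : col_mults k n :=
  [ffun x => g x.1 x.2].
have curK : cancel cur unc by move=> M; apply/ffunP => -[i c]; rewrite !ffunE.
have uncK : cancel unc cur.
  by move=> g; apply/ffunP => i; apply/ffunP => c; rewrite !ffunE.
rewrite [RHS](reindex cur) /=; last by exists unc => x _; [exact: curK|exact: uncK].
rewrite [RHS](eq_bigr (fun _ => 1%N)); last by move=> M _; rewrite big1.
apply: eq_bigl => M; rewrite inE.
have sE i : (\sum_c cur M i c = \sum_c M (i, c))%N.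
  by apply: eq_bigr => c _; rewrite !ffunE.
have cE i : [set c | (0 < cur M i c)%N] = colors_of M i.
  by apply/setP => c; rewrite !inE !ffunE.
apply/andP/familyP => [[/andP[MP /forallP Mj] /eqP <-] i|H].
  by apply/andP; rewrite sE hE // cE.
have {}H i : (\sum_c M (i, c) = lam i)%N /\ (#|colors_of M i| <= j)%N.
  by have /andP[/eqP] := H i; rewrite sE cE.
have MP : M \in col_partitions k n.
  rewrite inE; move: lamP; rewrite inE => /eqP e; rewrite -[eqbRHS]e.
  by apply/eqP; apply: eq_bigr => i _; rewrite -big_distrr /= (H i).1.
split; last by apply/eqP/ffunP => i; apply/val_inj; rewrite /= hE // (H i).1.
by rewrite MP; apply/forallP => i; rewrite (H i).2.
Qed.

(** * Overpartitions and multiplicities divisible by [p] *)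

Lemma pbar_sum (n : nat) : pbar n = (\sum_(lam in partitions n) 2 ^ r_of lam)%N.
Proof.
rewrite /pbar -sum1_card.
rewrite (eq_bigl (fun mo : mults n * {set 'I_n} =>
  (mo.1 \in partitions n) && (mo.2 \in powerset (part_sizes mo.1)))); last first.
  by move=> mo; rewrite !inE.
rewrite -(pair_big_dep (mem (partitions n))
  (fun lam A => A \in powerset (part_sizes lam)) (fun _ _ => 1%N)) /=.
by apply: eq_bigr => lam _; rewrite sum1_card card_powerset.
Qed.

Lemma sum_nonexceptional (p n : nat) : (0 < p)%N ->
  (\sum_(lam in partitions n | exc_sizes p lam == set0) 2 ^ r_of lam)%N
  = pbar_div n p.
Proof.
move=> p0.
have excP (lam : mults n) : reflect (forall i, p %| lam i)%N (exc_sizes p lam == set0).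
  apply: (iffP eqP) => [e i|H]; last by apply/setP => i; rewrite !inE H.
  by apply/negPn; have := in_set0 i; rewrite -e inE => ->.
rewrite /pbar_div; case: (boolP (p %| n)%N) => [/dvdnP[d en]|npn]; last first.
  rewrite big_pred0 // => lam; apply/negbTE/negP => /andP[].
  rewrite inE => /eqP e /excP H; case/negP: npn; rewrite -e.
  by apply: dvdn_sum => i _; apply: dvdn_mull.
have dn : (d <= n)%N by rewrite en leq_pmulr.
have -> : (n %/ p = d)%N by rewrite en mulnK.
rewrite pbar_sum.
(* [h] keeps the part sizes and scales the multiplicities by [p]; sizes above [d] get multiplicity
   0. On the partitions of [n] with all multiplicities divisible by [p], [h'] inverts it. *)
pose h (mu : mults d) : mults n :=
  [ffun i => inord (if insub (val i) is Some i' then mu i' * p else 0)%N].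
pose h' (lam : mults n) : mults d := [ffun i => inord (lam (widen_ord dn i) %/ p)%N].
have hE mu i : h mu i = (if insub (val i) is Some i' then mu i' * p else 0)%N :> nat.
  rewrite ffunE inordK //; case: insubP => // i' _ _.
  by rewrite ltnS en leq_mul2r -ltnS ltn_ord orbT.
have hW mu i : h mu (widen_ord dn i) = (mu i * p)%N :> nat.
  by rewrite hE insubT //= => lt; congr (mu _ * _)%N; apply/val_inj.
have hO mu (i : 'I_n) : (d <= i)%N -> h mu i = 0%N :> nat.
  by move=> di; rewrite hE insubF //= ltnNge di.
have narrow (G : 'I_n -> nat) : (forall i : 'I_n, d <= i -> G i = 0)%N ->
    (\sum_(i < n) G i = \sum_(i < d) G (widen_ord dn i))%N.
  move=> G0; rewrite -(big_ord_narrow (F := G) dn) [RHS]big_mkcond.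
  by apply: eq_bigr => i _; case: ltnP => // /G0.
rewrite (reindex_onto h h') /=; last first.
  move=> lam /andP[lamP /excP lamE]; apply/ffunP => i; apply/val_inj => /=.
  have le_i := @partition_mult_le n (fun i => lam i) _ i; rewrite /= in le_i.
  have {}le_i : (i.+1 * lam i <= n)%N by apply: le_i; apply/eqP; move: lamP; rewrite inE.
  have /dvdnP[a ea] := lamE i.
  have [id|di] := ltnP i d; last first.
    (* A size above [d] with a positive multiplicity divisible by [p] would contribute at least
       [(d + 1) * p > n]. *)
    rewrite hO //; case: a ea => [->//|a ea].
    move: le_i; rewrite ea [leqRHS]en mulnA leq_mul2r.
    by rewrite eqn0Ngt p0 /= leqNgt (leq_trans _ (leq_pmulr _ _)).
  have -> : i = widen_ord dn (Ordinal id) by apply/val_inj.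
  rewrite hW ffunE.
  have -> : widen_ord dn (Ordinal id) = i by apply/val_inj.
  rewrite ea mulnK // inordK // ltnS.
  move: le_i; rewrite ea [leqRHS]en mulnA leq_mul2r eqn0Ngt p0 /=.
  by apply: leq_trans; rewrite leq_pmull.
apply: eq_big => [mu|mu _].
  have -> : h' (h mu) == mu.
    by apply/eqP/ffunP => i; rewrite ffunE hW mulnK // inord_val.
  have -> : exc_sizes p (h mu) == set0.
    by apply/excP => i; rewrite hE; case: insubP => // *; rewrite dvdn_mull.
  rewrite !andbT !inE narrow; last by move=> i /hO ->; rewrite muln0.
  under eq_bigr do rewrite hW mulnA.
  by rewrite -big_distrl /= [X in (_ == X) = _]en eqn_pmul2r.
have r_sum q (lam : mults q) : r_of lam = (\sum_(i < q) (0 < lam i))%N.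
  by rewrite /r_of -sum1_card [LHS]big_mkcond; apply: eq_bigr => i _; rewrite inE; case: ltnP.
congr (2 ^ _)%N; rewrite !r_sum narrow; last by move=> i /hO ->.
by apply: eq_bigr => i _; rewrite hW muln_gt0 p0 andbT.
Qed.

(** * Products of weights modulo [p ^ 2] *)

Lemma prod_weight_multiples (p n : nat) (lam : mults n) (B : {set 'I_n}) :
  prime p -> {in B, forall i, p %| lam i}%N ->
  ((p ^ 2)%N%:Z %| (\prod_(i in B) weight (2 * p) p (lam i))%N%:Z
                   - 2 ^+ #|B :&: part_sizes lam|)%Z.
Proof.
move=> pp; have [k le_k] := ubnP #|B|.
elim: k => // k IH in B le_k *.
have [-> _|[i iB] BP] := set_0Vmem B; first by rewrite big_set0 set0I cards0 subrr.
rewrite (big_setD1 i) //= PoszM.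
have {IH} := IH (B :\ i); rewrite (cardsD1 i B) iB in le_k.
move=> /(_ le_k) IH.
have {}IH := IH (fun j jB => BP j (subsetP (subD1set _ _) j jB)).
(* An absent size has weight 1 and does not enter the exponent; a present one contributes a factor 2
   modulo [p ^ 2]. *)
have [m0|lam0] := posnP (lam i).
  have <- : (B :\ i) :&: part_sizes lam = B :&: part_sizes lam.
    by apply/setP => j; rewrite !inE; case: eqP => //= ->; rewrite m0 andbF.
  by rewrite m0 /= mul1r.
have -> : #|B :&: part_sizes lam| = #|(B :\ i) :&: part_sizes lam|.+1.
  rewrite (cardsD1 i) !inE iB lam0 add1n; congr _.+1.
  by apply: eq_card => j; rewrite !inE andbA.
have /dvdnP[t et] := BP i iB.
have t0 : (0 < t)%N by move: lam0; rewrite et muln_gt0 => /andP[].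
have := weight_multiple pp t0; rewrite -et exprS; move: IH.
set a := weight _ _ _; set c := 2 ^+ _; set b := (\prod_(_ in _) _)%N => hb ha.
have -> : a%:Z * b%:Z - 2 * c = (a%:Z - 2) * b%:Z + 2 * (b%:Z - c) by ring.
by apply: rpredD; [apply: dvdz_mulr|apply: dvdz_mull].
Qed.

Lemma prod_weight_exceptional (p n : nat) (lam : mults n) (yi : int) :
  prime p -> #|exc_sizes p lam| == 1%N ->
  ((y_of p lam)%:Z * yi = 1 %[mod p%:Z])%Z ->
  ((p ^ 2)%N%:Z %| (\prod_(i < n) weight (2 * p) p (lam i))%N%:Z
                   - p%:Z * (2 ^+ r_of lam * ((t_of p lam)%:Z + 1) * yi))%Z.
Proof.
move=> pp /cards1P[i ei] /eqP; rewrite eqz_mod_dvd /t_of /y_of.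
have -> : exc_mult p lam = lam i.
  rewrite /exc_mult; case: pickP => [j|/(_ i)]; rewrite ei inE ?eqxx //.
  by move/eqP->.
have npi : ~~ (p %| lam i)%N by have := set11 i; rewrite -ei inE.
move=> hy; have hw := weight_exceptional pp npi.
have pw := dvdn_weight pp npi.
have hB : {in [set~ i], forall j, p %| lam j}%N.
  by move=> j; rewrite -ei !inE negbK.
have hb := prod_weight_multiples pp hB; rewrite (bigD1 i) //=; move: hb.
rewrite (eq_bigl (fun j => j != i)); last by move=> j; rewrite !inE.
have -> : r_of lam = #|[set~ i] :&: part_sizes lam|.+1.
  rewrite /r_of (cardsD1 i) inE.
  have -> : (0 < lam i)%N by rewrite lt0n; apply: contraNneq npi => ->; rewrite dvdn0.
  by rewrite add1n; congr _.+1; apply: eq_card => j; rewrite !inE.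
rewrite exprS PoszM; move: hw hy pw.
set w := weight _ _ _; set t := (_ %/ _)%N; set y := (_ %% _)%N.
set c := 2 ^+ _; set b := (\prod_(_ < _ | _) _)%N => hw hy pw hb.
(* As [p] divides [w], and [y * yi] is 1 modulo [p], replacing [w] by [yi * y * w] costs only a
   multiple of [p ^ 2]. *)
have -> : w%:Z * b%:Z - p%:Z * (2 * c * (t%:Z + 1) * yi) =
  w%:Z * (b%:Z - c) + c * yi * (y%:Z * w%:Z - 2 * p%:Z * (t%:Z + 1))
  - c * (w%:Z * (y%:Z * yi - 1)) by ring.
apply: rpredB; first by apply: rpredD; apply: dvdz_mull.
apply: dvdz_mull; rewrite expnS expn1 PoszM; apply: dvdz_mul => //.
Qed.

Lemma prod_weight_two_exceptional (p n : nat) (lam : mults n) :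
  prime p -> (1 < #|exc_sizes p lam|)%N ->
  (p ^ 2 %| \prod_(i < n) weight (2 * p) p (lam i))%N.
Proof.
move=> pp /card_gt1P[i [j [iE jE ij]]].
rewrite (bigD1 i) //= (bigD1 j) 1?eq_sym //= mulnA dvdn_mulr // expnS expn1.
by apply: dvdn_mul; apply: dvdn_weight => //; [move: iE|move: jE]; rewrite inE.
Qed.

(** * Assembly of the congruence *)

Theorem theorem2 (p n : nat) (p_prime : prime p)
    (yinv : mults n -> int)
    (yinvP : forall lam : mults n, lam \in S_set p n ->
       ((y_of p lam)%:Z * yinv lam = 1 %[mod p%:Z])%Z) :
  ((ckj (2 * p)%N p n)%:Z
   = (pbar_div n p)%:Z
     + p%:Z * \sum_(lam in S_set p n)
                 2 ^+ r_of lam * ((t_of p lam)%:Z + 1) * yinv lam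
   %[mod (p ^ 2)%N%:Z])%Z.
Proof.
apply/eqP; rewrite eqz_mod_dvd.
rewrite ckj_weight -(sum_nonexceptional n (prime_gt0 p_prime)).
rewrite (bigID (fun lam => exc_sizes p lam == set0)) /=.
rewrite [X in (_ + X)%N](bigID (fun lam => #|exc_sizes p lam| == 1%N)) /=.
set A := (\sum_(_ | _ && (_ == set0)) _)%N.
set B := (\sum_(_ | _ && (_ == 1)) _)%N; set C := (\sum_(_ | _) _)%N.
set D := (\sum_(_ | _) _)%N; set E := p%:Z * _.
(* The three groups collect the partitions with no, exactly one, and at least two exceptional
   sizes. *)
have -> : (A + (B + C))%N%:Z - (D%:Z + E) = (A%:Z - D%:Z) + (B%:Z - E) + C%:Z :> int.
  by rewrite !PoszD; ring.
apply: rpredD; last first.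
  rewrite dvdzE /=; apply: dvdn_sum => lam /andP[/andP[_ e0] e1].
  apply: prod_weight_two_exceptional => //.
  by rewrite ltn_neqAle eq_sym e1 lt0n cards_eq0.
apply: rpredD.
  rewrite /A /D !(big_morph Posz PoszD (erefl _)) -sumrB.
  apply: rpred_sum => lam /andP[_ /eqP e0].
  have hT : {in [set: 'I_n], forall i, p %| lam i}%N.
    by move=> i _; apply/negPn; have := in_set0 i; rewrite -e0 inE => ->.
  have := prod_weight_multiples p_prime hT; rewrite setTI.
  rewrite (eq_bigl xpredT); last by move=> i; rewrite inE.
  by rewrite -/(r_of lam) -[Posz (2 ^ _)]natz natrX.
rewrite /B /E mulr_sumr (big_morph Posz PoszD (erefl _)).
rewrite (eq_bigl (mem (S_set p n))); last first.
  move=> lam; rewrite [RHS]inE -andbA; congr andb.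
  by rewrite -cards_eq0; case: #|_| => [|[]].
rewrite -sumrB; apply: rpred_sum => lam lamS.
apply: prod_weight_exceptional => //; last exact: yinvP.
by move: lamS; rewrite /= inE => /andP[].
Qed.
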